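(* Let $A,B$ be real symmetric $n\times n$ matrices, $f,g\in\mathbb{R}^n$, $\mu\in\mathbb{R}$, let $G(x)=x^TBx-2g^Tx$, and consider the problem (QP1QC): $\inf\, x^TAx-2f^Tx$ subject to $G(x)\le\mu$. Suppose the primal Slater condition holds (there exists $x_0$ with $G(x_0)<\mu$) and the optimal value of (QP1QC) is finite. Then the infimum of (QP1QC) is not attained if and only if $I_{\succeq}(A,B)=\{\sigma\in\mathbb{R}: A+\sigma B\succeq 0\}$ is a single-point set $\{\sigma^*\}$ with $\sigma^*\ge 0$ and the system in $y$ $$G\big((A+\sigma^*B)^+(f+\sigma^*g)+Vy\big)=\mu\ \text{ if } \sigma^*>0,\qquad G\big(A^+f+Vy\big)\le\mu\ \text{ if } \sigma^*=0,$$ has no solution $y$, where $V$ is a matrix whose columns form a basis of the null space $N(A+\sigma^*B)$.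
   Context: $M^+$ denotes the Moore–Penrose pseudoinverse of $M$; $M\succeq 0$ means positive semidefinite; $N(M)=\{v: Mv=0\}$. *)

(* Defs.v *)
From HB Require Import structures.
From mathcomp Require Import all_boot all_order all_algebra.
From mathcomp Require Import reals.
From Stdlib Require Import ClassicalEpsilon.
Set Implicit Arguments. Unset Strict Implicit. Unset Printing Implicit Defensive.
Import Order.TTheory GRing.Theory Num.Theory.
Local Open Scope ring_scope.

Definition qform (R : realType) (n : nat) (M : 'M[R]_n) (x : 'cV[R]_n) : R :=
  (x^T *m M *m x) 0 0.

Definition lform (R : realType) (n : nat) (f x : 'cV[R]_n) : R :=
  (f^T *m x) 0 0.

Definition psd (R : realType) (n : nat) (M : 'M[R]_n) : Prop :=
  forall x : 'cV[R]_n, 0 <= qform M x.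

Definition penrose (R : realType) (n : nat) (M X : 'M[R]_n) : Prop :=
  [/\ M *m X *m M = M, X *m M *m X = X,
      (M *m X)^T = M *m X & (X *m M)^T = X *m M].

(* Moore-Penrose pseudoinverse: the (unique, existing) matrix satisfying
   the Penrose conditions, picked by classical choice. *)
Definition pinv (R : realType) (n : nat) (M : 'M[R]_n) : 'M[R]_n :=
  epsilon (inhabits (0 : 'M[R]_n)) (fun X => penrose M X).

Definition null_basis (R : realType) (n k : nat) (M : 'M[R]_n) (V : 'M[R]_(n, k)) : Prop :=
  [/\ M *m V = 0, \rank V = k &
      forall v : 'cV[R]_n, M *m v = 0 -> exists y : 'cV[R]_k, v = V *m y].

(* Main.v *)
Require Import Defs.
From HB Require Import structures.
From mathcomp Require Import all_boot all_order all_algebra.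
From mathcomp Require Import reals.
From mathcomp Require Import classical_sets ring lra.
From Stdlib Require Import ClassicalEpsilon.
Import Order.TTheory GRing.Theory Num.Theory.
Local Open Scope ring_scope.

(** By the S-lemma there is a multiplier [s >= 0] with [F + s (G - mu) >= v],
    where [v] is the infimum.  Put [H = A + s B] and [h = f + s g]; then [H] is
    positive semidefinite, [H x = h] is solvable, and a minimizer is exactly a
    solution of [H x = h] that is feasible and complementary to [s].

    If the infimum is not attained, [G - mu] therefore has no zero on the affine
    space [S = {x | H x = h}], hence has constant sign there.  Suppose that
    [H + e B] is also positive semidefinite with [e <> 0].  If [e (G - mu) > 0]
    on [S], moving the multiplier slightly from [s] towards [s + e] raises the
    minimum of the Lagrangian strictly above [v], to first order by the minimum
    of [e (G - mu)] over [S]; this contradicts weak duality.  If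
    [e (G - mu) < 0] on [S], a convex function bounded above is constant, so
    the null space of [H] lies in that of [B]; then [H + e' B] is positive
    semidefinite for small [e'] of the opposite sign, which is the first case. *)

(** * Quadratic polynomials in one real variable *)

Section ScalarQuadratics.
Set Implicit Arguments. Unset Strict Implicit.
Variable R : realType.
Implicit Types a b c t : R.

Lemma quad_nonneg_lead_half a b c :
  (forall t, 0 <= t -> 0 <= c + b * t + a * t ^+ 2) -> 0 <= a.
Proof.
move=> q_ge0; rewrite leNgt; apply/negP => a_lt0.
have c_ge0 : 0 <= c by move: (q_ge0 0 (lexx _)); lra.
(* This choice makes [- a * (1 + w)] exceed [|b| + c], so the quadratic is negative at [1 + w]. *)
pose w := (`|b| + c) / - a.
have w_ge0 : 0 <= w by rewrite divr_ge0 ?addr_ge0 // oppr_ge0 ltW.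
have w_eq : w * - a = `|b| + c by rewrite divfK // oppr_eq0 lt_eqF.
have /q_ge0 : 0 <= 1 + w by lra.
by move: w_ge0 w_eq (ler_norm b); move: (w) (`|b|) => {}w k; nra.
Qed.

Lemma quad_nonneg_lead a b c :
  (forall t, 0 <= c + b * t + a * t ^+ 2) -> 0 <= a.
Proof. by move=> q_ge0; apply: (@quad_nonneg_lead_half a b c) => t _. Qed.

Lemma quad_nonneg_slope a b : (forall t, 0 <= b * t + a * t ^+ 2) -> b = 0.
Proof.
move=> q_ge0.
have a_ge0 : 0 <= a.
  by apply: (@quad_nonneg_lead a b 0) => t; rewrite add0r.
(* Since [b = w * (a + 1)], the polynomial takes the value [- w ^+ 2] at [- w]. *)
pose w := b / (a + 1).
have b_eq : b = w * (a + 1) by rewrite /w divfK //; lra.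
have := q_ge0 (- w); rewrite b_eq => w_le0.
have /eqP : w ^+ 2 = 0 by apply/eqP; rewrite eq_le sqr_ge0 andbT; nra.
by rewrite sqrf_eq0 => /eqP ->; rewrite mul0r.
Qed.

Lemma affine_nonneg_slope b c : (forall t, 0 <= c + b * t) -> b = 0.
Proof.
move=> l_ge0; apply/eqP/negPn/negP => b_neq0.
have := l_ge0 (- (c + 1) / b).
rewrite mulrC divfK //; lra.
Qed.

(** As [a * c < 0], the root [r] of the reduced discriminant exceeds [|b|], which fixes the signs of
    both roots. *)
Lemma quad_opposite_signs_roots a b c : a < 0 -> 0 < c ->
  exists t1 t2, [/\ t1 < 0, 0 < t2, a * t1 ^+ 2 + 2 * b * t1 + c = 0 &
                    a * t2 ^+ 2 + 2 * b * t2 + c = 0].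
Proof.
move=> a_lt0 c_gt0; pose r := Num.sqrt (b ^+ 2 - a * c).
have r2 : r ^+ 2 = b ^+ 2 - a * c.
  by rewrite sqr_sqrtr // subr_ge0; nra.
have r_ge0 : 0 <= r by exact: sqrtr_ge0.
have a_neq0 : a != 0 by rewrite lt_eqF.
have [rb1 rb2] : b < r /\ - b < r.
  have br : b ^+ 2 < r ^+ 2 by rewrite r2; nra.
  by split; nra.
exists ((r - b) / a), ((- r - b) / a); split.
- by rewrite pmulr_rlt0 ?invr_lt0 // subr_gt0.
- by rewrite nmulr_rgt0 ?invr_lt0 //; lra.
- have -> : a * ((r - b) / a) ^+ 2 + 2 * b * ((r - b) / a) + c
      = (r ^+ 2 - (b ^+ 2 - a * c)) / a by field.
  by rewrite r2 subrr mul0r.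
- have -> : a * ((- r - b) / a) ^+ 2 + 2 * b * ((- r - b) / a) + c
      = (r ^+ 2 - (b ^+ 2 - a * c)) / a by field.
  by rewrite r2 subrr mul0r.
Qed.

Lemma mulr_gt0_same_sign a b c : 0 < a * b -> 0 < c * a -> 0 < c * b.
Proof.
move=> ab ca; have a_neq0 : a != 0 by apply: contraTneq ab => ->; rewrite mul0r ltxx.
rewrite -(pmulr_rgt0 _ (_ : 0 < a ^+ 2)) ?exprn_even_gt0 //.
by have := mulr_gt0 ca ab; congr (0 < _); ring.
Qed.

End ScalarQuadratics.

(** * Quadratic functions of a vector: stationarity and boundedness *)

Section QuadraticFunctions.
Variables (R : realType) (n : nat).
Set Implicit Arguments. Unset Strict Implicit.
Implicit Types (H B : 'M[R]_n) (h g x y d : 'cV[R]_n).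

Lemma lformC m (u v : 'cV[R]_m) : lform u v = lform v u.
Proof. by rewrite /lform !mxE; apply: eq_bigr => i _; rewrite !mxE mulrC. Qed.

Lemma lformDr m (u v w : 'cV[R]_m) : lform u (v + w) = lform u v + lform u w.
Proof. by rewrite /lform mulmxDr mxE. Qed.

Lemma lformDl m (u v w : 'cV[R]_m) : lform (u + v) w = lform u w + lform v w.
Proof. by rewrite lformC lformDr !(lformC w). Qed.

Lemma lformZr m t (u v : 'cV[R]_m) : lform u (t *: v) = t * lform u v.
Proof. by rewrite /lform -scalemxAr mxE. Qed.

Lemma lformZl m t (u v : 'cV[R]_m) : lform (t *: u) v = t * lform u v.
Proof. by rewrite lformC lformZr lformC. Qed.

Lemma lformNr m (u v : 'cV[R]_m) : lform u (- v) = - lform u v.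
Proof. by rewrite -scaleN1r lformZr mulN1r. Qed.

Lemma lformNl m (u v : 'cV[R]_m) : lform (- u) v = - lform u v.
Proof. by rewrite lformC lformNr lformC. Qed.

Lemma lform0r m (u : 'cV[R]_m) : lform u 0 = 0.
Proof. by rewrite /lform mulmx0 mxE. Qed.

Lemma lform0l m (u : 'cV[R]_m) : lform 0 u = 0.
Proof. by rewrite lformC lform0r. Qed.

Definition lformE :=
  (lformDr, lformDl, lformZr, lformZl, lformNr, lformNl, lform0r, lform0l).

Lemma lform_mulmx m p (M : 'M[R]_(m, p)) (u : 'cV[R]_m) (v : 'cV[R]_p) :
  lform u (M *m v) = lform (M^T *m u) v.
Proof. by rewrite /lform trmx_mul trmxK mulmxA. Qed.

Lemma lform_sym H x y : H^T = H -> lform (H *m x) y = lform (H *m y) x.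
Proof. by move=> symH; rewrite lformC lform_mulmx symH. Qed.

Lemma lform_ge0 m (u : 'cV[R]_m) : 0 <= lform u u.
Proof. by rewrite /lform mxE sumr_ge0 // => i _; rewrite mxE -expr2 sqr_ge0. Qed.

Lemma lform_eq0 m (u : 'cV[R]_m) : lform u u = 0 -> u = 0.
Proof.
rewrite /lform mxE => /eqP; rewrite psumr_eq0 => [/allP u0|i _]; last first.
  by rewrite mxE -expr2 sqr_ge0.
apply/colP => i; have := u0 i (mem_index_enum _).
by rewrite !mxE mulf_eq0 orbb => /eqP.
Qed.

Lemma qformE H x : qform H x = lform (H *m x) x.
Proof. by rewrite lformC /qform /lform mulmxA. Qed.

Lemma qformDl H B x : qform (H + B) x = qform H x + qform B x.
Proof. by rewrite !qformE mulmxDl lformDl. Qed.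

Lemma qformZl t H x : qform (t *: H) x = t * qform H x.
Proof. by rewrite !qformE -scalemxAl lformZl. Qed.

Definition qfun H h x : R := qform H x - 2 * lform h x.

(** Up to the constant [- t * mu], this writes the Lagrangian as a single quadratic function. *)
Lemma qfun_comb H h B g t x :
  qfun (H + t *: B) (h + t *: g) x = qfun H h x + t * qfun B g x.
Proof. rewrite /qfun qformDl qformZl !lformE; ring. Qed.

Lemma qfun_expand H h x d t : H^T = H ->
  qfun H h (x + t *: d) =
  qfun H h x + 2 * lform (H *m x - h) d * t + qform H d * t ^+ 2.
Proof.
move=> symH; rewrite /qfun !qformE mulmxDr -scalemxAr !lformE.
rewrite (lform_sym d x symH); ring.
Qed.

Lemma qfun_stationary H h x d : H^T = H -> H *m x = h ->
  qfun H h (x + d) = qfun H h x + qform H d.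
Proof.
move=> symH Hx; have := qfun_expand h x d 1 symH.
by rewrite scale1r Hx subrr lform0l => ->; ring.
Qed.

(** The columns of [cokermx H] are null vectors of [H], and a row that they annihilate lies in the
    row space of [H]; symmetry turns rows into columns. *)
Lemma orth_null_range H (b : 'cV[R]_n) : H^T = H ->
  (forall d : 'cV[R]_n, H *m d = 0 -> lform b d = 0) -> exists x, H *m x = b.
Proof.
move=> symH b_orth.
suff /submxP[D bD] : (b^T <= H)%MS.
  by exists D^T; rewrite -(trmxK b) bD trmx_mul symH.
rewrite submxE; apply/eqP/rowP => j.
have := b_orth (col j (cokermx H)).
rewrite colE mulmxA mulmx_coker mul0mx => /(_ erefl).
by rewrite /lform mulmxA -colE !mxE.
Qed.

(** Boundedness on lines through the origin makes the leading coefficients nonnegative; on null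
    directions only the linear term is left and must vanish, so [h] is orthogonal to the null
    space. *)
Lemma qfun_bounded_below H h c : H^T = H ->
  (forall x, c <= qfun H h x) -> psd H /\ exists x, H *m x = h.
Proof.
move=> symH bnd.
have line d t : 0 <= (- c) + (- 2 * lform h d) * t + qform H d * t ^+ 2.
  move: (bnd (0 + t *: d)); rewrite qfun_expand //.
  have -> : qfun H h 0 = 0 by rewrite /qfun qformE !lformE; ring.
  by rewrite mulmx0 !lformE; lra.
split=> [d|]; first exact: quad_nonneg_lead (line d).
apply: orth_null_range => // d Hd; suff : - 2 * lform h d = 0 by lra.
apply: (@affine_nonneg_slope _ _ (- c)) => t.
by have := line d t; rewrite qformE Hd lform0l; lra.
Qed.

Lemma qfun_minimizer H h x0 : H^T = H ->
  (forall x, qfun H h x0 <= qfun H h x) -> H *m x0 = h.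
Proof.
move=> symH minx0; apply/eqP; rewrite -subr_eq0; apply/eqP.
(* Along the residual [r] itself, the slope at [x0] is twice the squared norm of [r]. *)
set r := _ - _; apply: lform_eq0.
have line t : 0 <= 2 * lform r r * t + qform H r * t ^+ 2.
  by move: (minx0 (x0 + t *: r)); rewrite qfun_expand //; rewrite -/r; lra.
suff : 2 * lform r r = 0 by lra.
exact: quad_nonneg_slope line.
Qed.

End QuadraticFunctions.

(** * Pseudoinverses, null spaces and bounds between quadratic forms *)

Section RealMatrices.
Set Implicit Arguments. Unset Strict Implicit.
Variable R : realType.

Lemma row_free_gram_unit m p (W : 'M[R]_(m, p)) :
  row_free W -> W *m W^T \in unitmx.
Proof.
move=> freeW; rewrite -row_free_unit; apply: inj_row_free => u uWW.
apply: (row_free_inj freeW); rewrite mul0mx.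
rewrite -[LHS]trmxK [X in X^T](_ : _ = 0) ?trmx0 //; apply: lform_eq0.
by rewrite /lform trmxK trmx_mul mulmxA -(mulmxA u) uWW mul0mx mxE.
Qed.

(** The witness is [W^T (W W^T)^-1 (C^T C)^-1 C^T], a right inverse of [W] times a left inverse of
    [C]. *)
Lemma penrose_full_rank_factorization n r (C : 'M[R]_(n, r)) (W : 'M[R]_(r, n)) :
  row_free C^T -> row_free W -> exists X, penrose (C *m W) X.
Proof.
move=> freeC freeW; pose WW := W *m W^T; pose CC := C^T *m C.
have WWu : WW \in unitmx by rewrite row_free_gram_unit.
have CCu : CC \in unitmx by rewrite /CC -[X in _ *m X]trmxK row_free_gram_unit.
pose P := W^T *m invmx WW; pose Q := invmx CC *m C^T.
have WP : W *m P = 1%:M by rewrite mulmxA mulmxV.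
have QC : Q *m C = 1%:M by rewrite -mulmxA mulVmx.
have symWW : WW^T = WW by rewrite trmx_mul trmxK.
have symCC : CC^T = CC by rewrite trmx_mul trmxK.
have MX : C *m W *m (P *m Q) = C *m Q by rewrite -mulmxA (mulmxA W) WP mul1mx.
have XM : P *m Q *m (C *m W) = P *m W by rewrite -mulmxA (mulmxA Q) QC mul1mx.
exists (P *m Q); split.
- by rewrite MX -mulmxA (mulmxA Q) QC mul1mx.
- by rewrite XM -mulmxA (mulmxA W) WP mul1mx.
- by rewrite MX !trmx_mul trmxK trmx_inv symCC mulmxA.
- by rewrite XM !trmx_mul trmxK trmx_inv symWW mulmxA.
Qed.

Lemma penrose_exists n (M : 'M[R]_n) : exists X, penrose M X.
Proof.
rewrite -{1}(mulmx_base M); apply: penrose_full_rank_factorization.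
  by rewrite /row_free mxrank_tr; exact: col_base_full.
exact: row_base_free.
Qed.

Lemma pinv_penrose n (M : 'M[R]_n) : penrose M (pinv M).
Proof. exact: epsilon_spec (penrose_exists M). Qed.

Lemma mulmx_pinv n (M : 'M[R]_n) (h x : 'cV[R]_n) :
  M *m x = h -> M *m (pinv M *m h) = h.
Proof. by case: (pinv_penrose M) => MXM _ _ _ <-; rewrite !mulmxA MXM. Qed.

Lemma null_basis_exists n (M : 'M[R]_n) :
  exists k (V : 'M[R]_(n, k)), null_basis M V.
Proof.
pose K := kermx M^T.
exists (\rank K), (row_base K)^T; split.
- apply: trmx_inj; rewrite trmx_mul trmxK trmx0.
  by apply/sub_kermxP; rewrite eq_row_base.
- by rewrite mxrank_tr; apply/eqP; exact: row_base_free.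
move=> v Mv; have : (v^T <= row_base K)%MS.
  by rewrite eq_row_base; apply/sub_kermxP; rewrite -trmx_mul Mv trmx0.
by case/submxP => D vD; exists D^T; rewrite -(trmxK v) vD trmx_mul.
Qed.

(** A zero of a semidefinite form minimizes it, so the gradient vanishes there. *)
Lemma psd_qform_eq0 n (H : 'M[R]_n) d : H^T = H -> psd H -> qform H d = 0 -> H *m d = 0.
Proof.
move=> symH psdH qd; rewrite (@qfun_minimizer _ _ H 0 d) // => x.
by rewrite /qfun qd !lform0l !mulr0 !subr0.
Qed.

Lemma qform_le_norm n (M : 'M[R]_n) :
  exists2 c : R, 0 < c & forall x, qform M x <= c * lform x x.
Proof.
exists (\sum_j \sum_i `|M i j| + 1) => [|x].
  by rewrite ltr_wpDl // sumr_ge0 // => j _; rewrite sumr_ge0.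
have sq_le i : x i 0 ^+ 2 <= lform x x.
  rewrite /lform mxE (bigD1 i) //= mxE -expr2 lerDl sumr_ge0 // => k _.
  by rewrite mxE -expr2 sqr_ge0.
rewrite mulrDl mul1r -[leLHS]addr0 lerD ?lform_ge0 //.
rewrite /qform mxE mulr_suml ler_sum // => j _.
rewrite mxE !mulr_suml ler_sum // => i _; rewrite mxE.
apply: le_trans (ler_norm _) _; rewrite !normrM mulrAC mulrC ler_wpM2l //.
have := sq_le i; have := sq_le j; rewrite -(real_normK (num_real (x i 0))).
rewrite -(real_normK (num_real (x j 0))).
have : 0 <= (`|x i 0| - `|x j 0|) ^+ 2 by rewrite sqr_ge0.
by rewrite sqrrB; lra.
Qed.

Lemma psd_image_norm_le n (H : 'M[R]_n) : H^T = H -> psd H ->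
  exists2 c : R, 0 < c & forall x, lform (H *m x) (H *m x) <= c * qform H x.
Proof.
move=> symH psdH; have [c c_gt0 le_c] := qform_le_norm H.
exists c => // x; set w := H *m x.
(* Nonnegativity after a gradient step of length [c^-1]: the bound on [qform H w] absorbs half of
   the linear decrease. *)
have := psdH (x + - c^-1 *: w).
have := qfun_expand 0 x w (- c^-1) symH.
rewrite /qfun !lform0l !mulr0 !subr0 -/w => ->.
have qw : qform H w * (- c^-1) ^+ 2 <= lform w w * c^-1.
  rewrite sqrrN expr2 mulrA ler_wpM2r //; first by rewrite invr_ge0 ltW.
  by rewrite ler_pdivrMr // mulrC.
move=> q_ge0; rewrite mulrC -ler_pdivrMr //; lra.
Qed.

(** Since [x] and [pinv H *m (H *m x)] differ by a null vector of [H], the form of [B] depends on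
    [H *m x] alone, whose norm is controlled by the form of [H]. *)
Lemma psd_dominates n (H B : 'M[R]_n) : H^T = H -> psd H -> B^T = B ->
  (forall d : 'cV[R]_n, H *m d = 0 -> B *m d = 0) ->
  exists2 c : R, 0 < c & forall x, qform B x <= c * qform H x.
Proof.
move=> symH psdH symB nullHB.
have [HPH _ _ _] := pinv_penrose H; set P := pinv H in HPH.
have [c1 c1_gt0 le1] := psd_image_norm_le symH psdH.
have [c2 c2_gt0 le2] := qform_le_norm (P^T *m B *m P).
exists (c2 * c1); first exact: mulr_gt0.
move=> x; pose y := P *m (H *m x).
have BxE : B *m x = B *m y.
  apply/eqP; rewrite -subr_eq0 -mulmxBr; apply/eqP/nullHB.
  by rewrite mulmxBr /y !mulmxA HPH subrr.
have -> : qform B x = qform (P^T *m B *m P) (H *m x).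
  rewrite !qformE BxE lform_sym // BxE lformC -!mulmxA [in RHS]lformC.
  by rewrite [RHS]lform_mulmx trmxK.
apply: le_trans (le2 _) _; rewrite -mulrA ler_wpM2l //; exact: ltW.
Qed.

Lemma psd_perturbation_both_signs n (H B : 'M[R]_n) :
  H^T = H -> psd H -> B^T = B -> (forall d : 'cV[R]_n, H *m d = 0 -> B *m d = 0) ->
  exists2 t : R, 0 < t & psd (H + t *: B) /\ psd (H + - t *: B).
Proof.
move=> symH psdH symB nullHB.
have [c c_gt0 le_c] := psd_dominates symH psdH symB nullHB.
have [c' c'_gt0 le_c'] : exists2 c : R, 0 < c & forall x, qform (- B) x <= c * qform H x.
  apply: psd_dominates => //; first by rewrite raddfN /= symB.
  by move=> d /nullHB Bd; rewrite mulNmx Bd oppr0.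
have cc_gt0 : 0 < c + c' by lra.
(* [c] serves [B] and [c'] serves [- B], so the inverse of their sum suits both signs. *)
exists (c + c')^-1; first by rewrite invr_gt0.
have qN x : qform (- B) x = - qform B x by rewrite -scaleN1r qformZl mulN1r.
split=> x; rewrite qformDl qformZl; have := psdH x; have := le_c x; have := le_c' x;
  rewrite qN => h1 h2 h3.
  suff : - (c + c')^-1 * qform B x <= qform H x by lra.
  by rewrite mulNr -mulrN mulrC ler_pdivrMr //; nra.
suff : (c + c')^-1 * qform B x <= qform H x by lra.
by rewrite mulrC ler_pdivrMr //; nra.
Qed.

End RealMatrices.

(** * The S-lemma for one quadratic constraint *)

Section SLemma.
Set Implicit Arguments. Unset Strict Implicit.
Variables (R : realType) (n : nat) (A B : 'M[R]_n) (f g : 'cV[R]_n) (mu : R).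
Hypotheses (symA : A^T = A) (symB : B^T = B).
Implicit Types x y d : 'cV[R]_n.

Let F := qfun A f.
Let G := qfun B g.

(** With [u = 1 / (1 + t)], clearing denominators turns [G - mu] on the segment into a quadratic in
    [t] with leading coefficient [G y - mu] and constant term [G x - mu]; opposite signs give a
    positive root. *)
Lemma qfun_segment_level x y : mu < G x -> G y < mu ->
  exists2 u : R, 0 < u < 1 & G (y + u *: (x - y)) = mu.
Proof.
move=> Gx Gy.
have Gline t : G (y + t *: (x - y)) = _ := qfun_expand g y (x - y) t symB.
have := Gline 1; rewrite scale1r addrC subrK -/G => Gx_eq.
set b := lform _ _ in Gline Gx_eq; set a := qform _ _ in Gline Gx_eq.
have neg : G y - mu < 0 by lra.
have pos : 0 < G x - mu by lra.
have [_ [t [_ t_gt0 _ rt]]] := quad_opposite_signs_roots (G y - mu + b) neg pos.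
have t1_neq0 : 1 + t != 0 by lra.
exists (1 + t)^-1; first by rewrite invr_gt0 invf_lt1; lra.
rewrite Gline; apply/eqP; rewrite -subr_eq0 -/G.
have -> : G y + 2 * b * (1 + t)^-1 + a * (1 + t)^-1 ^+ 2 - mu =
   ((G y - mu) * t ^+ 2 + 2 * (G y - mu + b) * t + (G y + 2 * b + a - mu)) / (1 + t) ^+ 2.
  by field.
suff -> : G y + 2 * b + a = G x by rewrite rt mul0r.
by rewrite Gx_eq; ring.
Qed.

Variable v : R.
Hypothesis v_le : forall x, G x <= mu -> v <= F x.

Lemma recession_ge0 y d : G y < mu -> qform B d = 0 -> 0 <= qform A d.
Proof.
move=> Gy qBd.
(* Up to the sign of [d], [G] does not increase along the ray from [y], so the ray is feasible and
   [F] is bounded below on it. *)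
wlog slope : d qBd / lform (B *m y - g) d <= 0 => [th|].
  have [/th->//|slope_gt0] := leP (lform (B *m y - g) d) 0.
  have qN M : qform M (- d) = qform M d.
    by rewrite !qformE mulmxN !lformE opprK.
  rewrite -qN; apply: th; first by rewrite qN.
  by rewrite lformE; lra.
set k := lform (A *m y - f) d.
apply: (@quad_nonneg_lead_half _ _ (2 * k) (F y - v)) => t t_ge0.
have : v <= F (y + t *: d).
  by apply: v_le; rewrite /G qfun_expand // qBd -/G; nra.
by rewrite /F qfun_expand // -/k -/F; lra.
Qed.

(** The line through [x] and [y] meets the level [mu] of [G] at two points, one possibly at
    infinity. The bound on [F] at each gives two inequalities, from which the linear term is
    eliminated. *)
Lemma slemma_cross x y : mu < G x -> G y < mu ->
  0 <= (F y - v) * (G x - mu) - (F x - v) * (G y - mu).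
Proof.
move=> Gx Gy.
have Gline t : G (y + t *: (x - y)) = _ := qfun_expand g y (x - y) t symB.
have Fline t : F (y + t *: (x - y)) = _ := qfun_expand f y (x - y) t symA.
have := Gline 1; have := Fline 1; rewrite scale1r addrC subrK -/F -/G.
have rec := @recession_ge0 y (x - y) Gy.
set bF := lform _ _ in Fline *; set bG := lform _ _ in Gline *.
set aF := qform A _ in rec Fline *; set aG := qform B _ in rec Gline *.
move=> Fx_eq Gx_eq.
have neg : G y - mu < 0 by lra.
have pos : 0 < G x - mu by lra.
have [t1 [t2 [t1_lt0 t2_gt0 rt1 rt2]]] :=
  quad_opposite_signs_roots (G y - mu + bG) neg pos.
have F_ge0 t :
    (G y - mu) * t ^+ 2 + 2 * (G y - mu + bG) * t + (G x - mu) = 0 ->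
    0 <= (F y - v) * t ^+ 2 + 2 * (F y - v + bF) * t + (F x - v).
  (* [t = -1] is the point at infinity: the equation then says that [qform B (x - y)] is zero, and
     [recession_ge0] replaces feasibility. *)
  move=> rt; have [t1_eq0|t1_neq0] := eqVneq (1 + t) 0.
    have tE : t = -1 by lra.
    rewrite {}tE in rt *.
    have : 0 <= aF by apply: rec; move: rt; rewrite Gx_eq; lra.
    by rewrite Fx_eq; lra.
  have : v <= F (y + (1 + t)^-1 *: (x - y)).
    apply: v_le; rewrite Gline -subr_le0 -/G.
    have -> : G y + 2 * bG * (1 + t)^-1 + aG * (1 + t)^-1 ^+ 2 - mu =
      ((G y - mu) * t ^+ 2 + 2 * (G y - mu + bG) * t +
       (G y + 2 * bG + aG - mu)) / (1 + t) ^+ 2 by field.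
    suff -> : G y + 2 * bG + aG = G x by rewrite rt mul0r.
    by rewrite Gx_eq; ring.
  rewrite Fline -subr_ge0 -/F.
  have -> : F y + 2 * bF * (1 + t)^-1 + aF * (1 + t)^-1 ^+ 2 - v =
    ((F y - v) * t ^+ 2 + 2 * (F y - v + bF) * t +
     (F y + 2 * bF + aF - v)) / (1 + t) ^+ 2 by field.
  rewrite pmulr_lge0; last by rewrite invr_gt0 exprn_even_gt0 //= t1_neq0.
  suff -> : F y + 2 * bF + aF = F x by [].
  by rewrite Fx_eq; ring.
have := F_ge0 _ rt1; have := F_ge0 _ rt2; move: rt1 rt2 t1_lt0 t2_gt0 pos neg.
clear.
move: (F y - v) (F x - v) (G y - mu) (G x - mu) => p q r s.
move: (p + bF) (r + bG) => e h rt1 rt2 t1_lt0 t2_gt0 pos neg F2 F1.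
(* Vieta: the product of the two roots is [s / r]. *)
have prod_roots : r * t1 * t2 = s.
  have d_neq0 : t2 - t1 != 0 by lra.
  by apply: (mulfI d_neq0); nra.
(* Weights [t2] on the inequality at [t1] and [- t1] on the one at [t2] cancel the linear term. *)
have : 0 <= (t2 - t1) * (q - p * t1 * t2) by nra.
rewrite pmulr_rge0; last by lra.
move=> comb; rewrite -prod_roots; nra.
Qed.

(** The multiplier is the supremum of the slopes at infeasible points; by [slemma_cross] each
    strictly feasible point bounds them above. Adding 0 to the set makes it nonempty and the
    multiplier nonnegative. *)
Lemma slemma : (exists y, G y < mu) ->
  exists2 s : R, 0 <= s & forall x, v <= F x + s * (G x - mu).
Proof.
move=> [y0 Gy0].
pose E : set R :=
  fun r => r = 0 \/ exists2 x, mu < G x & r = (v - F x) / (G x - mu).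
have ubE y : G y < mu -> ubound E ((F y - v) / (mu - G y)).
  move=> Gy r [->|[x Gx ->]].
    by rewrite divr_ge0 // subr_ge0 ?v_le // ltW.
  rewrite ler_pdivrMr ?subr_gt0 // mulrAC ler_pdivlMr ?subr_gt0 //.
  by have := slemma_cross Gx Gy; lra.
have supE : has_sup E.
  by split; [exists 0; left | exists ((F y0 - v) / (mu - G y0)); exact: ubE].
exists (sup E); first by apply: ub_le_sup => //; [exact: supE.2 | left].
move=> x; have [Gx|Gx|Gx] := ltgtP (G x) mu.
- have := ge_sup supE.1 (ubE _ Gx).
  by rewrite ler_pdivlMr ?subr_gt0 //; lra.
- have : (v - F x) / (G x - mu) <= sup E.
    by apply: ub_le_sup; [exact: supE.2 | right; exists x].
  by rewrite ler_pdivrMr ?subr_gt0 //; lra.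
- by rewrite Gx subrr mulr0 addr0 v_le // Gx.
Qed.

End SLemma.

(** * Moving the multiplier inside the semidefinite pencil *)

Section MultiplierPerturbation.
Set Implicit Arguments. Unset Strict Implicit.
Variables (R : realType) (n : nat) (H B : 'M[R]_n) (h g : 'cV[R]_n) (mu : R).
Hypotheses (symH : H^T = H) (symB : B^T = B) (psdH : psd H).
Implicit Types x y d : 'cV[R]_n.

Let L := qfun H h.
Let G := qfun B g.

(** On the solutions of [H x = h] the quadratic [e * (G - mu)] is bounded below, so it has a
    stationary point; there its gradient is orthogonal to the null space of [H], hence in the range
    of [H]. *)
Lemma stationary_minimizer e : psd (H + e *: B) ->
  (exists x, H *m x = h) -> (forall x, H *m x = h -> 0 < e * (G x - mu)) ->
  exists x b, H *m x = h /\ e *: (B *m x - g) = H *m b.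
Proof.
move=> psdHe [x0 Hx0] pos.
(* The columns of the square matrix [N] span the null space of [H], so
   minimising over [H x = h] becomes an unconstrained problem in [y]. *)
pose N := (kermx H)^T.
have HN0 : H *m N = 0.
  by apply: trmx_inj; rewrite trmx_mul trmxK symH mulmx_ker trmx0.
have NP d : H *m d = 0 -> exists y, d = N *m y.
  move=> Hd; have : (d^T <= kermx H)%MS.
    by apply/sub_kermxP; rewrite -[X in _ *m X]symH -trmx_mul Hd trmx0.
  by case/submxP => D dD; exists D^T; rewrite -(trmxK d) dD trmx_mul.
have HxN y : H *m (x0 + N *m y) = h by rewrite mulmxDr mulmxA HN0 mul0mx addr0.
pose K := N^T *m (e *: B) *m N; pose k := N^T *m (e *: (g - B *m x0)).
have symK : K^T = K.
  by rewrite /K /N !trmx_mul !trmxK linearZ /= symB !mulmxA.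
have KE y : qfun K k y = e * G (x0 + N *m y) - e * G x0.
  have := qfun_expand g x0 (N *m y) 1 symB; rewrite scale1r -/G => ->.
  by rewrite /qfun !qformE /K /k -!mulmxA -!lform_mulmx -!scalemxAl !lformE; ring.
have [|_ [y Ky]] := @qfun_bounded_below _ _ K k (e * mu - e * G x0) symK.
  by move=> y; have := pos _ (HxN y); rewrite KE; lra.
have [b Hb] : exists b, H *m b = e *: (B *m (x0 + N *m y) - g).
  apply: orth_null_range => // d /NP [z ->].
  rewrite lform_mulmx.
  have -> : N^T *m (e *: (B *m (x0 + N *m y) - g)) = K *m y - k.
    rewrite /K /k -!mulmxA -!scalemxAl -mulmxBr; congr (_ *m _).
    by rewrite -scalerBr mulmxDr opprB addrA [B *m x0 + _]addrC.
  by rewrite Ky subrr lform0l.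
by exists (x0 + N *m y), b.
Qed.

Lemma perturbed_lagrangian_gap e : psd (H + e *: B) ->
  (exists x, H *m x = h) -> (forall x, H *m x = h -> 0 < e * (G x - mu)) ->
  exists2 E : R, 0 < E & forall t, 0 < t < E -> exists2 eta, 0 < eta &
    forall x0 x, H *m x0 = h -> L x0 + eta <= L x + t * e * (G x - mu).
Proof.
move=> psdHe exS pos; have [xb [b [Hxb Hb]]] := stationary_minimizer psdHe exS pos.
pose delta := e * (G xb - mu); have delta_gt0 : 0 < delta by exact: pos.
have q_ge0 := psdH b; set q := qform H b in q_ge0.
(* The bound 1/2 leaves half of [qform H d] for completing a square; the other keeps [2 * t * q]
   below [delta]. *)
pose E := Num.min (1 / 2) (delta / (2 * q + 1)).
have q1_gt0 : 0 < 2 * q + 1 by lra.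
exists E; first by rewrite lt_min divr_gt0 // divr_gt0.
move=> t; rewrite lt_min !ltr_pdivlMr // => /andP[t_gt0 /andP[t_lt tq_lt]].
exists (t * (delta - 2 * t * q)) => [|x0 x Hx0].
  by rewrite mulr_gt0 //; nra.
have -> : L x0 = L xb.
  have := qfun_stationary (x0 - xb) symH Hxb.
  rewrite addrC subrK -/L => ->.
  by rewrite qformE mulmxBr Hx0 Hxb subrr lform0l addr0.
pose d := x - xb.
have LE : L x = L xb + qform H d.
  by have := qfun_stationary d symH Hxb; rewrite addrC subrK.
have GE : e * (G x - mu) = delta + 2 * lform (H *m b) d + e * qform B d.
  have := qfun_expand g xb d 1 symB; rewrite scale1r addrC subrK -/G => ->.
  by rewrite -Hb lformZl /delta -/G; ring.
(* This square absorbs the cross term at the cost [2 * t ^+ 2 * q], while [t] times the form of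
   [H + e *: B] absorbs the curvature of [G]. *)
have sq := psdH (d + (2 * t) *: b).
have := qfun_expand 0 d b (2 * t) symH; rewrite /qfun !lform0l !mulr0 !subr0.
rewrite -/q => sqE; rewrite {}sqE in sq.
have bd : lform (H *m d) b = lform (H *m b) d by exact: lform_sym.
rewrite {}bd in sq.
have := psdHe d; rewrite qformDl qformZl => He_ge0.
have Hd_ge0 := psdH d.
rewrite -(mulrA t e) GE LE; move: sq He_ge0 Hd_ge0.
move: (qform H d) (lform _ _) (e * qform B d) => p c r sq He_ge0 Hd_ge0.
have : 0 <= t * (p + r) by apply: mulr_ge0 => //; exact: ltW.
nra.
Qed.

(* When [e (G - mu)] is negative on the affine space [H x = h], convexity makes
   it constant there, so [B] vanishes on the null space of [H] and both signs
   of perturbation keep [H] positive semidefinite. *)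
Lemma psd_perturbation_opposite e : psd (H + e *: B) -> e != 0 ->
  (exists x, H *m x = h) -> (forall x, H *m x = h -> e * (G x - mu) < 0) ->
  exists e', psd (H + e' *: B) /\ forall x, H *m x = h -> 0 < e' * (G x - mu).
Proof.
move=> psdHe e_neq0 [x0 Hx0] neg.
have nullHB d : H *m d = 0 -> B *m d = 0.
  move=> Hd; have qHd : qform H d = 0 by rewrite qformE Hd lform0l.
  have eB_ge0 : 0 <= e * qform B d.
    by have := psdHe d; rewrite qformDl qformZl qHd add0r.
  have eB_le0 : 0 <= - (e * qform B d).
    apply: (@quad_nonneg_lead _ _ (- e * (2 * lform (B *m x0 - g) d))
      (- (e * (G x0 - mu)))) => t.
    have : H *m (x0 + t *: d) = h by rewrite mulmxDr -scalemxAr Hd scaler0 addr0.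
    by move/neg; rewrite /G qfun_expand // -/G; lra.
  have : (H + e *: B) *m d = 0.
    apply: psd_qform_eq0 => //; first by rewrite linearD linearZ /= symH symB.
    by rewrite qformDl qformZl qHd; lra.
  rewrite mulmxDl Hd add0r -scalemxAl => /eqP.
  by rewrite scaler_eq0 (negPf e_neq0) => /eqP.
have [t t_gt0 [psd1 psd2]] := psd_perturbation_both_signs symH psdH symB nullHB.
have [e_gt0|e_le0] := ltP 0 e.
  exists (- t); split=> // x /neg; nra.
have e_lt0 : e < 0 by rewrite lt_neqAle e_neq0.
by exists t; split=> // x /neg; nra.
Qed.

End MultiplierPerturbation.

(** * Optimality conditions with and without a minimizer *)

Section Attainment.
Set Implicit Arguments. Unset Strict Implicit.
Variables (R : realType) (n : nat) (A B : 'M[R]_n) (f g : 'cV[R]_n) (mu : R).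
Hypotheses (symA : A^T = A) (symB : B^T = B).
Hypothesis slater : exists x, qfun B g x < mu.

Let F := qfun A f.
Let G := qfun B g.

Let sym_pencil s : (A + s *: B)^T = A + s *: B.
Proof. by rewrite linearD linearZ /= symA symB. Qed.

(** The S-lemma inequality for the value [F xs], read at [xs] itself, gives complementarity; then
    [xs] minimizes the Lagrangian. *)
Lemma minimizer_kkt xs : G xs <= mu -> (forall x, G x <= mu -> F xs <= F x) ->
  exists2 s : R, 0 <= s & [/\ psd (A + s *: B), (A + s *: B) *m xs = f + s *: g &
                          s * (G xs - mu) = 0].
Proof.
move=> Gxs min_xs; have [s s_ge0 Ls] := slemma symA symB min_xs slater.
rewrite -/F -/G in Ls.
have slack : s * (G xs - mu) = 0.
  have slack_ge0 := Ls xs.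
  apply/eqP; rewrite eq_le; apply/andP; split; last lra.
  by rewrite mulr_ge0_le0 // subr_le0.
have Lmin x : F xs + s * mu <= qfun (A + s *: B) (f + s *: g) x.
  by rewrite qfun_comb -/F -/G; have := Ls x; lra.
exists s => //; split=> //; first by case: (qfun_bounded_below (sym_pencil s) Lmin).
apply: qfun_minimizer => // x; apply: le_trans (Lmin x).
by rewrite qfun_comb -/F -/G; lra.
Qed.

(** The last clause serves both cases of the system: it excludes [G x = mu] when [s > 0] and
    [G x <= mu] when [s = 0]. *)
Lemma unattained_kkt :
  (exists lb, forall x, G x <= mu -> lb <= F x) ->
  ~ (exists xs, G xs <= mu /\ forall x, G x <= mu -> F xs <= F x) ->
  exists2 s : R, 0 <= s & [/\ forall s', psd (A + s' *: B) <-> s' = s,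
    exists x, (A + s *: B) *m x = f + s *: g &
    forall x, (A + s *: B) *m x = f + s *: g -> s * (G x - mu) = 0 -> mu < G x].
Proof.
move=> [lb lbP] unatt.
pose E : set R := fun r => exists2 x, G x <= mu & r = F x.
have infE : has_inf E.
  split; first by case: slater => y Gy; exists (F y), y => //; exact: ltW.
  by exists lb => _ [x Gx ->]; exact: lbP.
pose v := inf E.
have v_le x : G x <= mu -> v <= F x.
  by move=> Gx; apply: ge_inf; [exact: infE.2 | exists x].
have v_adh eta : 0 < eta -> exists2 x, G x <= mu & F x < v + eta.
  by move=> /inf_adherent/(_ infE) [_ [x Gx ->] Fx]; exists x.
have [s s_ge0 Ls] := slemma symA symB v_le slater; rewrite -/F -/G in Ls.
have LE t x : qfun (A + t *: B) (f + t *: g) x = F x + t * G x := qfun_comb _ _ _ _ _ _.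
have Lbnd x : v + s * mu <= qfun (A + s *: B) (f + s *: g) x.
  by rewrite LE; have := Ls x; lra.
have [psdH exS] := qfun_bounded_below (sym_pencil s) Lbnd.
(* Stationary points minimize the Lagrangian, which is at most [F] at near-optimal feasible
   points. *)
have LS x : (A + s *: B) *m x = f + s *: g -> F x + s * (G x - mu) = v.
  move=> Hx; apply/eqP; rewrite eq_le Ls andbT; apply/ler_addgt0Pr => eta eta_gt0.
  have [y Gy Fy] := v_adh _ eta_gt0.
  have := qfun_stationary (y - x) (sym_pencil s) Hx.
  rewrite (addrC x) subrK !LE; have := psdH (y - x).
  have : s * (G y - mu) <= 0 by rewrite mulr_ge0_le0 // subr_le0.
  by lra.
have comp x : (A + s *: B) *m x = f + s *: g -> s * (G x - mu) = 0 -> mu < G x.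
  move=> Hx slack; rewrite ltNge; apply/negP => Gx; apply: unatt; exists x.
  by split=> // y Gy; have := LS _ Hx; rewrite slack addr0 => ->; exact: v_le.
have ne_mu x : (A + s *: B) *m x = f + s *: g -> G x != mu.
  move=> Hx; apply/eqP => Gx.
  by have := comp _ Hx; rewrite Gx subrr mulr0 ltxx => /(_ erefl).
exists s => //; split=> // s'; split=> [psds'|->//].
apply/eqP/negPn/negP => s'_neq.
have pencilE e : A + s *: B + e *: B = A + (s + e) *: B.
  by rewrite -addrA -scalerDl.
pose e := s' - s; have e_neq0 : e != 0 by rewrite subr_eq0.
have psde : psd (A + s *: B + e *: B) by rewrite pencilE (addrC s) subrK.
(* The gap lifts the Lagrangian at [s + t * e'] to at least [v + eta]; a feasible point with [F]
   below [v + eta] contradicts this once that multiplier is nonnegative. *)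
have no_pos e' : psd (A + s *: B + e' *: B) ->
    (forall x, (A + s *: B) *m x = f + s *: g -> 0 < e' * (G x - mu)) -> False.
  move=> psde' pos.
  have [T T_gt0 gap] := perturbed_lagrangian_gap (sym_pencil s) symB psdH psde' exS pos.
  have [t /andP[t_gt0 tT] t_ge] : exists2 t : R, 0 < t < T & 0 <= s + t * e'.
    (* For [s > 0] a small [t] is enough; for [s = 0] complementarity is automatic, so [G > mu] on
       the solutions and [e'] must be positive. *)
    have [s_gt0|s_le0] := ltP 0 s.
      exists (Num.min (T / 2) (s / (`|e'| + 1))).
        rewrite lt_min gt_min !divr_gt0 //=; last by rewrite ltr_pwDr.
        by apply/orP; left; lra.
      set t := Num.min _ _.
      have t_le : t * (`|e'| + 1) <= s.
        by rewrite -ler_pdivlMr ?ltr_pwDr // /t ge_min lexx orbT.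
      have t_ge0 : 0 <= t.
        by rewrite le_min !divr_ge0 ?addr_ge0 // ltW.
      have : 0 <= t * (`|e'| + e').
        by rewrite mulr_ge0 // -lerBlDr sub0r -normrN ler_norm.
      by lra.
    have s0 : s = 0 by lra.
    have [x Hx] := exS; have := comp _ Hx; rewrite s0 mul0r => /(_ erefl) Gx.
    have := pos _ Hx; rewrite pmulr_lgt0 ?subr_gt0 // => e'_gt0.
    exists (T / 2); first by apply/andP; split; lra.
    by rewrite add0r mulr_ge0 ?divr_ge0 // ltW.
  have [|eta eta_gt0 etaP] := gap t; first by rewrite t_gt0.
  have [x0 Hx0] := exS; have [x Gx Fx] := v_adh _ eta_gt0.
  have := etaP _ x Hx0; rewrite !LE -/G; have := LS _ Hx0.
  have : (s + t * e') * (G x - mu) <= 0 by rewrite mulr_ge0_le0 // subr_le0.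
  by lra.
have [x0 Hx0] := exS.
have const_sign x : (A + s *: B) *m x = f + s *: g -> 0 < (G x0 - mu) * (G x - mu).
  move=> Hx.
  (* The solution set contains the segment from [y] to [z], which would cross the level [mu]. *)
  have no_level y z : (A + s *: B) *m y = f + s *: g ->
      (A + s *: B) *m z = f + s *: g -> G y < mu -> mu < G z -> False.
    move=> Hy Hz Gy Gz; have [u _ Gu] := qfun_segment_level symB Gz Gy.
    have /ne_mu/eqP : (A + s *: B) *m (y + u *: (z - y)) = f + s *: g.
      by rewrite mulmxDr -scalemxAr mulmxBr Hy Hz subrr scaler0 addr0.
    by apply.
  have := ne_mu _ Hx; have := ne_mu _ Hx0; rewrite !neq_lt.
  move=> /orP[G0|G0] /orP[G1|G1].
  - by rewrite nmulr_rgt0 subr_lt0.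
  - by case: (no_level _ _ Hx0 Hx G0 G1).
  - by case: (no_level _ _ Hx Hx0 G1 G0).
  - by rewrite mulr_gt0 // subr_gt0.
have [pos0|neg0|zero0] := ltgtP 0 (e * (G x0 - mu)).
- by apply: (no_pos e) => // x /const_sign /mulr_gt0_same_sign; exact.
- have [|e' [psde' pos']] := psd_perturbation_opposite (g := g) (mu := mu)
    (sym_pencil s) symB psdH psde e_neq0 exS.
    move=> x /const_sign sgn; have := @mulr_gt0_same_sign _ _ _ (- e) sgn.
    by rewrite !mulNr !oppr_gt0; apply.
  exact: (no_pos e').
- move/eqP: zero0; rewrite eq_sym mulf_eq0 (negPf e_neq0) subr_eq0 /=.
  by rewrite (negPf (ne_mu _ Hx0)).
Qed.

End Attainment.

(** * From stationary points to the system in [y] *)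

Theorem theorem7 (R : realType) (n : nat) (A B : 'M[R]_n) (f g : 'cV[R]_n) (mu : R)
  (symA : A^T = A) (symB : B^T = B)
  (slater : exists x0 : 'cV[R]_n, qform B x0 - 2 * lform g x0 < mu)
  (finite : exists lb : R, forall x : 'cV[R]_n,
      qform B x - 2 * lform g x <= mu -> lb <= qform A x - 2 * lform f x) :
  let G := fun x : 'cV[R]_n => qform B x - 2 * lform g x in
  let F := fun x : 'cV[R]_n => qform A x - 2 * lform f x in
  ~ (exists xs : 'cV[R]_n, G xs <= mu /\ forall x, G x <= mu -> F xs <= F x)
  <->
  exists sigs : R,
    (forall sigma : R, psd (A + sigma *: B) <-> sigma = sigs) /\ 0 <= sigs /\
    forall (k : nat) (V : 'M[R]_(n, k)), null_basis (A + sigs *: B) V ->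
      ~ exists y : 'cV[R]_k,
          if 0 < sigs
          then G (pinv (A + sigs *: B) *m (f + sigs *: g) + V *m y) = mu
          else G (pinv A *m f + V *m y) <= mu.
Proof.
move=> G F; split=> [unatt|[s [psdP [s_ge0 no_sol]]] [xs [Gxs min_xs]]].
  have [s s_ge0 [psdP [x Hx] comp]] := unattained_kkt symA symB slater finite unatt.
  exists s; split=> //; split=> // k V [HV _ _] [y].
  set x1 := pinv (A + s *: B) *m (f + s *: g) + V *m y.
  have Hx1 : (A + s *: B) *m x1 = f + s *: g.
    by rewrite mulmxDr (mulmx_pinv Hx) mulmxA HV mul0mx addr0.
  have [s_gt0 Gx1|s_le0] := ltP 0 s.
    by have := comp _ Hx1; rewrite [qfun _ _ _]Gx1 subrr mulr0 ltxx => /(_ erefl).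
  have s0 : s = 0 by apply/eqP; rewrite eq_le s_le0.
  have -> : pinv A *m f + V *m y = x1 by rewrite /x1 s0 !scale0r !addr0.
  by have := comp _ Hx1; rewrite s0 mul0r => /(_ erefl); rewrite ltNge => /negP.
(* The multiplier of [xs] makes the pencil semidefinite, so it is the single point [s]. *)
have [t t_ge0 [/psdP ts Hxs slack]] := minimizer_kkt symA symB slater Gxs min_xs.
rewrite {}ts in t_ge0 Hxs slack.
have [k [V nbV]] := null_basis_exists (A + s *: B).
apply: (no_sol k V nbV); have [_ _ spanV] := nbV.
(* Two solutions of the same linear system differ by a null vector, whose coordinates in [V] solve
   the excluded system. *)
have [|y yP] := spanV (xs - pinv (A + s *: B) *m (f + s *: g)).
  by rewrite mulmxBr (mulmx_pinv Hxs) Hxs subrr.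
exists y; rewrite -yP; case: ifPn => [s_gt0|].
  rewrite addrC subrK; apply/eqP; rewrite -subr_eq0.
  by move/eqP: slack; rewrite mulf_eq0 gt_eqF.
rewrite -leNgt => s_le0; have s0 : s = 0 by apply/eqP; rewrite eq_le s_le0.
by rewrite s0 !scale0r !addr0 addrC subrK.
Qed.
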